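(* For all types $\sigma,\tau\Vdash n$, the coefficient of $p_{\tau}^{\otimes}$ in the $p^{\otimes}$-expansion of $E^+_{\sigma}$ is \[ \mathcal{M}(E^+,p^{\otimes})_{\tau,\sigma}=\sum_{T\in\mathrm{ICRHT}(\tau,\sigma)} \operatorname{sgn}^+(T)\operatorname{wt}(T). \] The coefficient of $p_{\tau}^{\otimes}$ in the $p^{\otimes}$-expansion of $E_{\sigma}$ is \[ \mathcal{M}(E,p^{\otimes})_{\tau,\sigma}=\sum_{T\in\mathrm{ICRHT}(\tau,\sigma)} \operatorname{sgn}^-(T)\operatorname{wt}(T). \]
   Context: An integer partition is a finite (possibly empty) weakly decreasing sequence of positive integers; $m_i(\lambda)$ is the number of parts of $\lambda$ equal to $i$, and $z_\lambda=\prod_{i\ge1}i^{m_i(\lambda)}m_i(\lambda)!$. A block is an ordered pair of positive integers written $d^m$ (degree $d$, multiplicity $m$). Blocks are ordered by $a^b\ge d^e$ iff $a>d$, or $a=d$ and $b\ge e$. A type is a finite (possibly empty) weakly decreasing sequence of blocks $\tau=(a_1^{b_1},\dots,a_t^{b_t})$; $\tau\Vdash n$ means $\sum_ia_ib_i=n$; its length is $\ell(\tau)=t$ and its sign is $\operatorname{sgn}(\tau)=\prod_{i=1}^t(-1)^{b_i}$. For $k\ge1$, $\tau|_k$ denotes the integer partition formed by the multiplicities of the blocks of $\tau$ of degree $k$; the type $\tau$ is determined by $(\tau|_k)_{k\ge1}$. Put $z^\otimes_\tau=\prod_{k\ge1}z_{\tau|_k}$. The tensor diagram of $\tau$ is the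 sequence of partition diagrams $\mathrm{dg}(\tau|_1)\otimes\mathrm{dg}(\tau|_2)\otimes\cdots$; the $k$th component has rows (left-justified, longest at top) of lengths the parts of $\tau|_k$. Variables: $x_{k,j}$ for $k,j\ge 1$, with $\deg x_{k,j}=k$; $\mathbf{x}_{k*}=(x_{k,1},x_{k,2},\dots)$. The graded algebra $\mathsf{P\Lambda}=\bigoplus_n\mathsf{P\Lambda}^n$ of polysymmetric functions consists of the formal series over $\mathbb{Q}$ of bounded degree in all the $x_{k,j}$ that, for each fixed $k$, are unchanged by any permutation of the variables $\mathbf{x}_{k*}$. Define $p^{\otimes}_\tau=\prod_{k\ge1}p_{\tau|_k}(\mathbf{x}_{k*})$, where $p_\lambda$ is the power-sum symmetric function; $\{p^\otimes_\tau:\tau\Vdash n\}$ is a basis of $\mathsf{P\Lambda}^n$. $E^+_d$ is the sum of all square-free monomials (no variable repeated) of degree $d$ in the variables $x_{k,j}$ (with $\deg x_{k,j}=k$); $E_d$ is the sum of the same monomials, each multiplied by $(-1)^q$ where $q$ is the number of variables in the monomial. $E^+_{d^m}$ and $E_{d^m}$ are obtained from $E^+_d$ and $E_d$ by replacing every variable $x_{k,j}$ by $x_{k,j}^m$; for $\sigma=(d_1^{m_1},\dots,d_s^{m_s})$, $E^+_\sigma=\prod_{i=1}^sE^+_{d_i^{m_i}}$ and $E_\sigma=\prod_{i=1}^sE_{d_i^{m_i}}$. For $F\in\{E^+,E\}$ the transition matrix is defined by $F_\sigma=\sum_{\tau\Vdash n}\mathcal{M}(F,p^\otimes)_{\tau,\sigma}p^\otimes_\tau$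 for $\sigma\Vdash n$. For $\sigma=(d_1^{m_1},\dots,d_s^{m_s})$, $\mathrm{ICRHT}(\tau,\sigma)$ is the set of increasing constant-row $H$-tableaux of shape $\tau$ and content $\sigma$: fillings $T$ of the cells of the tensor diagram of $\tau$ with integers $1,\dots,s$ such that: (i) each row of each component is constant; (ii) for $1\le i\le s$, the cells containing $i$ form a sub-tensor diagram equal to $\mathrm{dg}(m_i\rho^{(i)})$ for some type $\rho^{(i)}\Vdash d_i$, i.e., for each $k$ the multiset of lengths of the rows of component $k$ filled with $i$ is the multiset of parts of $\rho^{(i)}|_k$ each multiplied by $m_i$; (iii) for each $r,k$, the values in the rows of length $r$ in component $k$ weakly increase reading down the first column. The weight is $\operatorname{wt}(T)=\prod_{i=1}^s1/z^\otimes_{\rho^{(i)}}$, and the signs are $\operatorname{sgn}^+(T)=\prod_{i=1}^s(-1)^{\ell(\rho^{(i)})}\operatorname{sgn}(\rho^{(i)})$ and $\operatorname{sgn}^-(T)=\prod_{i=1}^s(-1)^{\ell(\rho^{(i)})}$. *)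

(* Defs.v *)
From HB Require Import structures.
From mathcomp Require Import all_boot all_order all_algebra finmap.
From mathcomp.multinomials Require Import monalg.
From mathcomp Require Import mathcomp_extra boolp classical_sets functions.
From mathcomp Require Import cardinality fsbigop.

Set Implicit Arguments.
Unset Strict Implicit.
Unset Printing Implicit Defensive.

Import GRing.Theory.

Local Open Scope classical_set_scope.
Local Open Scope ring_scope.

(* The block [d^m] is the pair [(d, m)].  *)
Definition block_ge (x y : nat * nat) : bool :=
  (y.1 < x.1)%N || (y.1 == x.1) && (y.2 <= x.2)%N.

Definition is_type (s : seq (nat * nat)) : bool :=
  all (fun b => (0 < b.1)%N && (0 < b.2)%N) s && sorted block_ge s.

Record ptype := PType { blocks :> seq (nat * nat); blocksP : is_type blocks }.

HB.instance Definition _ := [isSub for blocks].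
HB.instance Definition _ := [Choice of ptype by <:].

Definition ptype0 : ptype := @PType [::] isT.

Definition type_size (tau : ptype) : nat := (\sum_(b <- tau) b.1 * b.2)%N.

Notation "tau ||- n" := (type_size tau = n) (at level 70).

(* Sums over [\in] a classical set are 0 when the support is infinite; this and
   [finite_factorizations] rule that out below.  *)
Lemma finite_types (n : nat) : finite_set [set tau : ptype | tau ||- n].
Proof.
pose D := [set: n.-bseq ('I_n.+1 * 'I_n.+1)].
pose f (s : n.-bseq ('I_n.+1 * 'I_n.+1)) : ptype :=
  insubd ptype0 [seq (nat_of_ord b.1, nat_of_ord b.2) | b <- s].
apply: (@sub_finite_set _ _ (f @` D)); last first.
  exact/finite_image/finite_finset.
move=> tau /= taun.
have /andP[/allP tau_gt0 _] := blocksP tau.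
have tau_le b : b \in blocks tau -> (b.1 * b.2 <= n)%N.
  by move=> btau; rewrite -taun /type_size (big_rem b)//= leq_addr.
have size_le : (size tau <= n)%N.
  rewrite -taun /type_size -sum1_size big_seq [leqRHS]big_seq.
  apply: leq_sum => b /tau_gt0 /andP[b1 b2].
  by rewrite muln_gt0 b1.
pose s := [seq (inord b.1 : 'I_n.+1, inord b.2 : 'I_n.+1) | b <- blocks tau].
have s_le : (size s <= n)%N by rewrite size_map.
exists (Bseq s_le) => //; apply/val_inj; rewrite /f /= /s -map_comp.
rewrite (_ : map _ _ = blocks tau); first by rewrite val_insubd blocksP.
rewrite -[RHS]map_id; apply/eq_in_map => -[a b] abtau /=.
have /= := tau_le _ abtau; have /= /andP[a0 b0] := tau_gt0 _ abtau.
move=> le_n; rewrite !inordK// ltnS; apply: leq_trans le_n.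
  by rewrite leq_pmull.
by rewrite leq_pmulr.
Qed.

(* The partition tau|_k; it is weakly decreasing because [tau] is sorted.  *)
Definition restr (tau : ptype) (k : nat) : seq nat :=
  [seq b.2 | b <- blocks tau & b.1 == k].

Definition degrees (tau : ptype) : seq nat := undup [seq b.1 | b <- blocks tau].

Definition type_sgn (tau : ptype) : rat := \prod_(b <- tau) (-1) ^+ b.2.

Definition zpart (la : seq nat) : nat :=
  (\prod_(i <- undup la) (i ^ count_mem i la * (count_mem i la)`!))%N.

(* The degrees [k] that do not occur in [tau] contribute the factor 1, here and
   in [ptensor].  *)
Definition ztensor (tau : ptype) : nat :=
  (\prod_(k <- degrees tau) zpart (restr tau k))%N.

(* [(k, j)] stands for x_(k,j), of degree [k].  *)
Definition var : choiceType :=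
  {v : nat * nat | (0 < v.1)%N && (0 < v.2)%N}.

Definition mon : choiceType := {cmonom var}.

Definition vdeg (v : var) : nat := (val v).1.

Definition wdeg (m : mon) : nat := (\sum_(v <- finsupp m) m v * vdeg v)%N.

(* A series is its coefficient function.  Multiplication is convolution; type
   [mon -> rat] itself carries the pointwise product, hence the new name.
   Polysymmetric functions form a subalgebra of [series].  *)
Definition series : Type := mon -> rat.

HB.instance Definition _ := GRing.Lmodule.copy series (mon -> rat^o).

Definition sone : series := fun m => (m == mone)%:R.

Definition smul (f g : series) : series := fun m =>
  \sum_(ab \in [set ab : mon * mon | mmul ab.1 ab.2 = m]) f ab.1 * g ab.2.

Section SeriesRing.
Implicit Types (f g h : series) (m a b c : mon).

Lemma finite_divisors m : finite_set [set a : mon | exists b, mmul a b = m].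
Proof.
pose f (h : {ffun finsupp m -> 'I_(mdeg m).+1}) : mon :=
  [cmonom (nat_of_ord (h i)) | i : finsupp m]%M.
apply: (@sub_finite_set _ _ (f @` [set: {ffun finsupp m -> 'I_(mdeg m).+1}])).
  move=> a [b abm].
  exists [ffun i => inord (a (val i))] => //.
  apply/eqP/cmP => i; rewrite /f cmE.
  have am j : (a j <= m j)%N by rewrite -abm cmM leq_addr.
  case: (boolP (i \in finsupp m)) => im.
    rewrite fsfun_ffun insubT /= ffunE inordK// ltnS.
    by apply: leq_trans (am i) _; rewrite mdegE (big_fsetD1 i)//= leq_addr.
  rewrite fsfun_ffun insubF//=; last exact: negbTE.
  by apply/esym/eqP; rewrite -leqn0 (leq_trans (am i))// leqn0 cmE_eq0.
exact/finite_image/finite_finset.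
Qed.

Lemma mmulI a : injective (mmul a).
Proof.
move=> b c /eqP/cmP abc; apply/eqP/cmP => i.
by have := abc i; rewrite !cmM => /addnI.
Qed.

Lemma finite_factorizations m :
  finite_set [set ab : mon * mon | mmul ab.1 ab.2 = m].
Proof.
have fD := finite_divisors m.
apply: sub_finite_set (finite_setX fD fD) => -[a b] /= abm; split => /=.
  by exists b.
by exists a; rewrite mulmC.
Qed.

Let divs m : {fset mon} := fset_set [set a : mon | exists b, mmul a b = m].

Let in_divs m a b : mmul a b = m -> a \in divs m.
Proof.
by move=> abm; rewrite in_fset_set ?inE; [exists b|exact: finite_divisors].
Qed.

Let smul_sum (D : {fset mon}) f g m : {subset divs m <= D} ->
  smul f g m = \sum_(a <- D) \sum_(b <- D)
    (if mmul a b == m then f a * g b else 0).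
Proof.
move=> sD.
rewrite /smul (_ : mkset _ =
    [set` (fun ab : mon * mon => mmul ab.1 ab.2 == m)]); last first.
  by apply/seteqP; split=> ab /= /eqP.
rewrite -(@bigfs _ _ _ _ [seq (a, b) | a <- D, b <- D])/=; last 2 first.
- apply: allpairs_uniq; [exact: fset_uniq|exact: fset_uniq|].
  by move=> -[? ?] [? ?] _ _ /= [-> ->].
- move=> [a b] /= /eqP abm /negP[]; apply/allpairsP; exists (a, b).
  split=> //=; apply: sD; first exact: in_divs abm.
  by apply: (@in_divs _ _ a); rewrite mulmC.
by rewrite big_mkcond big_allpairs_dep.
Qed.

Let divs_sub a b m : mmul a b = m -> {subset divs a <= divs m}.
Proof.
move=> abm c; rewrite in_fset_set ?inE; last exact: finite_divisors.
by move=> [d cda]; apply: (@in_divs _ _ (mmul d b)); rewrite mulmA cda.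
Qed.

Let smulC : commutative smul.
Proof.
move=> f g; apply/funext => m.
rewrite !(@smul_sum (divs m))// exchange_big; apply: eq_bigr => a _.
by apply: eq_bigr => b _; rewrite mulmC mulrC.
Qed.

Let smul3 f g h m (D := divs m) : smul f (smul g h) m =
  \sum_(a <- D) \sum_(b <- D) \sum_(c <- D)
    (if mmul a (mmul b c) == m then f a * g b * h c else 0).
Proof.
pose F a b c := if mmul a (mmul b c) == m then f a * g b * h c else 0.
rewrite (@smul_sum D)//; apply: eq_bigr => a _.
transitivity (\sum_(u <- D) \sum_(b <- D) \sum_(c <- D)
    if u == mmul b c then F a b c else 0).
  apply: eq_bigr => u _; case: eqP => [aum|aum]; last first.
    rewrite big1// => b _; rewrite big1// => c _.
    by case: eqP => // ubc; rewrite /F -ubc; case: eqP.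
  rewrite (@smul_sum D); last by apply: (@divs_sub _ a); rewrite mulmC.
  rewrite mulr_sumr; apply: eq_bigr => b _.
  rewrite mulr_sumr; apply: eq_bigr => c _.
  rewrite eq_sym; case: eqP => [ubc|_]; last by rewrite mulr0.
  by rewrite /F -ubc aum eqxx mulrA.
rewrite exchange_big; apply: eq_bigr => b _.
rewrite exchange_big; apply: eq_bigr => c _.
rewrite -big_mkcond /F; case: eqP => [abcm|]; last by rewrite big1.
have bcD : mmul b c \in D by apply: (@in_divs _ _ a); rewrite mulmC.
by rewrite -big_filter (filter_pred1_uniq (fset_uniq _) bcD) big_seq1.
Qed.

Let smulA : associative smul.
Proof.
move=> f g h; apply/funext => m; rewrite (smulC (smul f g)) !smul3.
rewrite [RHS]exchange_big; apply: eq_bigr => a _.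
rewrite [RHS]exchange_big; apply: eq_bigr => b _; apply: eq_bigr => c _ /=.
by rewrite [in RHS]mulmC -mulmA -(mulrA (h c)) (mulrC (h c)).
Qed.

Let smul1 : left_id sone smul.
Proof.
move=> f; apply/funext => m; rewrite (@smul_sum (divs m))//.
have m1 : mone \in divs m by apply: (@in_divs _ _ m); rewrite mul1m.
have mm : m \in divs m by apply: (@in_divs _ _ mone); rewrite mulm1.
rewrite (bigD1_seq mone m1 (fset_uniq _))/= [X in _ + X]big1 ?addr0; last first.
  move=> a /negbTE a1; rewrite big1// => b _.
  by rewrite /sone a1 mul0r; case: ifP.
rewrite (bigD1_seq m mm (fset_uniq _))/= mul1m eqxx big1 ?addr0; last first.
  by move=> b /negbTE bm; rewrite mul1m bm.
by rewrite /sone eqxx mul1r.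
Qed.

Let smulDl : left_distributive smul +%R.
Proof.
move=> f g h; apply/funext => m.
rewrite [RHS](_ : _ = smul f h m + smul g h m)// !(@smul_sum (divs m))//.
rewrite -big_split; apply: eq_bigr => a _.
rewrite -big_split; apply: eq_bigr => b _ /=.
by case: ifP; rewrite ?addr0// -mulrDl.
Qed.

Let sone_neq0 : sone != 0.
Proof.
by apply/eqP => /(congr1 (fun f : series => f mone)); rewrite /sone eqxx.
Qed.

HB.instance Definition _ := GRing.Zmodule_isComNzRing.Build series
  smulA smulC smul1 smulDl sone_neq0.

Let sscaleAl (c : rat) f g : c *: (f * g) = (c *: f) * g.
Proof.
apply/funext => m.
rewrite [LHS](_ : _ = (c : rat) * smul f g m)//.
rewrite [RHS](_ : _ = smul (c *: f) g m)//.
rewrite !(@smul_sum (divs m))// mulr_sumr; apply: eq_bigr => a _.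
rewrite mulr_sumr; apply: eq_bigr => b _.
by case: ifP; rewrite ?mulr0 ?mulrA.
Qed.

HB.instance Definition _ := GRing.Lmodule_isLalgebra.Build rat series sscaleAl.
HB.instance Definition _ := GRing.Lalgebra_isComAlgebra.Build rat series.

End SeriesRing.

(* The power sum p_r(x_(k,1), x_(k,2), ...), for [r > 0].  *)
Definition pow_sum (k r : nat) : series := fun m =>
  `[< exists v : var, vdeg v = k /\ m = expcmn (ucm v) r >]%:R.

Definition ppart (k : nat) (la : seq nat) : series :=
  \prod_(r <- la) pow_sum k r.

Definition ptensor (tau : ptype) : series :=
  \prod_(k <- degrees tau) ppart k (restr tau k).

Definition squarefree (m : mon) : bool := all (fun v => m v == 1%N) (finsupp m).

Definition Eplus_deg (d : nat) : series := fun m =>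
  if squarefree m && (wdeg m == d) then 1 else 0.

Definition Eminus_deg (d : nat) : series := fun m =>
  if squarefree m && (wdeg m == d) then (-1) ^+ size (finsupp m) else 0.

(* The substitution x_(k,j) := x_(k,j)^r, for [r > 0]: the coefficient of the
   monomial [m] is collected from the (at most one) monomial [u] with
   [u ^ r = m].  *)
Definition subst_pow (r : nat) (f : series) : series := fun m =>
  \sum_(u \in [set u : mon | expcmn u r = m]) f u.

Definition Eplus (sigma : ptype) : series :=
  \prod_(b <- blocks sigma) subst_pow b.2 (Eplus_deg b.1).

Definition Eminus (sigma : ptype) : series :=
  \prod_(b <- blocks sigma) subst_pow b.2 (Eminus_deg b.1).

(* [M] is the transition matrix M(F, p^(x)) in degree [n]; the entry
   M(F, p^(x))_(tau, sigma) is [M tau sigma].  *)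
Definition is_transition (n : nat) (F : ptype -> series)
    (M : ptype -> ptype -> rat) : Prop :=
  forall sigma : ptype, sigma ||- n ->
    F sigma = \sum_(tau \in [set tau : ptype | tau ||- n])
                 M tau sigma *: ptensor tau.

(* Row [r] of component [k] of the tensor diagram of [tau] is the pair
   [(k, r)]; a cell is [((k, r), c)], with column [c].  Rows, columns and the
   entries of a filling are numbered from 0.  *)
Definition row_len (tau : ptype) (kr : nat * nat) : nat :=
  nth 0%N (restr tau kr.1) kr.2.

Definition rows (tau : ptype) : seq (nat * nat) :=
  [seq (k, r) | k <- degrees tau, r <- iota 0 (size (restr tau k))].

Definition cells (tau : ptype) : seq (nat * nat * nat) :=
  [seq (kr, c) | kr <- rows tau, c <- iota 0 (row_len tau kr)].

Definition cell (tau : ptype) : finType := seq_sub (cells tau).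

Definition cell_row (tau : ptype) (x : cell tau) : nat * nat := (ssval x).1.
Definition cell_col (tau : ptype) (x : cell tau) : nat := (ssval x).2.

Definition filling (tau sigma : ptype) : finType :=
  {ffun cell tau -> 'I_(size sigma)}.

Definition block_of (sigma : ptype) (i : 'I_(size sigma)) : nat * nat :=
  tnth (in_tuple (blocks sigma)) i.

Section Tableaux.
Variables (tau sigma : ptype).
Implicit Types (T : filling tau sigma) (i : 'I_(size sigma)) (rho : ptype).

Definition constant_rows T : Prop :=
  forall x y : cell tau, cell_row x = cell_row y -> T x = T y.

Definition row_filled T i (kr : nat * nat) : bool :=
  [forall x : cell tau, (cell_row x == kr) ==> (T x == i)].

Definition filled_lengths T i (k : nat) : seq nat :=
  [seq row_len tau (k, r)
     | r <- iota 0 (size (restr tau k)) & row_filled T i (k, r)].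

(* The cells of [T] containing [i] form [dg(m_i rho)] and [rho ||- d_i].  *)
Definition subdiagram T i rho : Prop :=
  rho ||- (block_of i).1 /\
  forall k, perm_eq (filled_lengths T i k)
                    [seq ((block_of i).2 * p)%N | p <- restr rho k].

Definition increasing T : Prop :=
  forall x y : cell tau,
    cell_col x = 0%N -> cell_col y = 0%N ->
    (cell_row x).1 = (cell_row y).1 ->
    row_len tau (cell_row x) = row_len tau (cell_row y) ->
    ((cell_row x).2 <= (cell_row y).2)%N -> (T x <= T y)%N.

Definition ICRHT : set (filling tau sigma) :=
  [set T | [/\ constant_rows T,
               forall i, exists rho, subdiagram T i rho
             & increasing T]].

(* The type rho^(i): for [T] in [ICRHT] exactly one [rho] qualifies.  *)
Definition rho_of T i : ptype := xget ptype0 [set rho | subdiagram T i rho].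

Definition wt T : rat := \prod_(i < size sigma) (ztensor (rho_of T i))%:R^-1.

Definition sgn_plus T : rat :=
  \prod_(i < size sigma) ((-1) ^+ size (rho_of T i) * type_sgn (rho_of T i)).

Definition sgn_minus T : rat :=
  \prod_(i < size sigma) (-1) ^+ size (rho_of T i).

End Tableaux.

Arguments ICRHT tau sigma : clear implicits.

(* Main.v *)
Require Import Defs.
From mathcomp Require Import all_boot all_order all_algebra finmap.
From mathcomp.multinomials Require Import monalg.
From mathcomp Require Import boolp classical_sets functions cardinality fsbigop.
From mathcomp Require Import zify ring.
Import Order.TTheory GRing.Theory Num.Theory.
Local Open Scope classical_set_scope.
Local Open Scope ring_scope.

Set Implicit Arguments.
Unset Strict Implicit.
Unset Printing Implicit Defensive.

(** The generating series of the square-free monomials, each weighted by [eps]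
    to the number of its variables, is the product over all variables [x_(k,j)]
    of [1 + eps x_(k,j) t^k]; [eps = 1] gives [E+] and [eps = -1] gives [E].
    Its logarithm is the sum over [k] and [r] of
    [- (- eps)^r (pow_sum k r) t^(k r) / r], and the exponential of that sum has
    at [t^d] the sum over the types [rho] of [d] of
    [exp_coef eps rho *: ptensor rho], where [exp_coef eps rho] is the product
    of the signs [- (- eps)^r] of the blocks of [rho], over [z_rho].  To prove
    this without a series in [t], differentiate in [t]: the coefficients on both
    sides satisfy the same recursion in [d] ([E_deg_newton] for square-free
    monomials, [exp_part_newton] for types), so they agree
    ([E_deg_exp_part]).

    Replacing every variable by its [m]-th power is a ring morphism sending
    [p_r] to [p_(m r)].  Hence [E_sigma], a product over the blocks [d_i^m_i] of
    [sigma], expands as a sum over the families [(rho^(i))_i] with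
    [rho^(i) ||- d_i]: such a family contributes the product of its
    coefficients to [ptensor tau], where [tau] is the union of the
    [m_i rho^(i)] ([E_type_expand]).

    The families with union [tau] correspond to the tableaux in
    [ICRHT tau sigma] by [T |-> (rho_of T i)_i] ([ICRHT_bij]).  The entries of a
    tableau attach to each part of [tau|_k] the index [i] of the type it comes
    from.  The family determines the multiset of the pairs (length, index) in
    component [k], and the condition on rows of equal length says that these
    pairs are listed in lexicographic order, so that the multiset determines
    the tableau.

    This gives one transition matrix.  It is the only one because the
    [ptensor tau] are linearly independent ([ptensor_free]): a monomial with
    distinct variables, one of degree [k] and exponent [r] for each block [k^r]
    of [tau], occurs in [ptensor tau], and among the other products it occurs
    only in those with more factors than [tau]. *)

(** * Types as multisets of blocks *)

Lemma block_ge_trans : transitive block_ge.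
Proof. by move=> [a b] [c d] [e f]; rewrite /block_ge /=; lia. Qed.

Lemma block_ge_anti : antisymmetric block_ge.
Proof. by move=> [a b] [c d]; rewrite /block_ge /= => ?; congr pair; lia. Qed.

Lemma block_ge_total : total block_ge.
Proof. by move=> [a b] [c d]; rewrite /block_ge /=; lia. Qed.

Lemma ptype_perm (s t : ptype) : perm_eq s t -> s = t.
Proof.
move=> st; apply/val_inj; apply: (sorted_eq block_ge_trans block_ge_anti) => //.
- by have /andP[] := blocksP s.
- by have /andP[] := blocksP t.
Qed.

Definition positive_blocks (s : seq (nat * nat)) : bool :=
  all (fun b => (0 < b.1)%N && (0 < b.2)%N) s.

Lemma ptype_positive (t : ptype) : positive_blocks t.
Proof. by have /andP[] := blocksP t. Qed.

(** The default [ptype0] is returned when some block has degree or multiplicity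
    0. *)
Definition type_of (s : seq (nat * nat)) : ptype :=
  insubd ptype0 (sort block_ge s).

Lemma perm_type_of s : positive_blocks s -> perm_eq (type_of s) s.
Proof.
move=> s_gt0; rewrite /type_of val_insubd /is_type all_sort.
by rewrite [all _ _]s_gt0 sort_sorted ?perm_sort//; exact: block_ge_total.
Qed.

Lemma type_of_size s : positive_blocks s ->
  type_size (type_of s) = (\sum_(b <- s) b.1 * b.2)%N.
Proof.
by move=> s_gt0; rewrite /type_size (perm_big _ (perm_type_of s_gt0)).
Qed.

Lemma big_degrees (R : Type) (idx : R) (op : Monoid.com_law idx) (t : ptype)
    (s : seq (nat * nat)) (F : nat * nat -> R) :
  {subset s <= blocks t} ->
  \big[op/idx]_(k <- degrees t) \big[op/idx]_(b <- s | b.1 == k) F b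
  = \big[op/idx]_(b <- s) F b.
Proof.
move=> st; rewrite (exchange_big_dep xpredT)//= big_seq [RHS]big_seq.
apply: eq_bigr => b /st bt; rewrite (eq_bigl (pred1 b.1)); last first.
  by move=> k; rewrite /= eq_sym.
rewrite -big_filter filter_pred1_uniq ?big_seq1 ?undup_uniq//.
by rewrite mem_undup map_f.
Qed.

Lemma ptensorE (t : ptype) : ptensor t = \prod_(b <- t) pow_sum b.1 b.2.
Proof.
rewrite -(@big_degrees _ _ _ t)//; apply: eq_bigr => k _.
rewrite /ppart /restr big_map big_filter; apply: eq_bigr => b /eqP <- //.
Qed.

(** This is [z^(x)] read off the whole multiset of blocks: the multiplicity
    of [r] in [tau|_k] is that of the block [k^r] in [tau]. *)
Definition zblocks (s : seq (nat * nat)) : nat :=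
  (\prod_(b <- undup s) (b.2 ^ count_mem b s * (count_mem b s)`!))%N.

Definition by_degree (k : nat) (s : seq (nat * nat)) : seq nat :=
  [seq b.2 | b <- s & b.1 == k].

Lemma count_by_degree k l (s : seq (nat * nat)) :
  count_mem l (by_degree k s) = count_mem (k, l) s.
Proof.
rewrite /by_degree count_map count_filter; apply: eq_count => -[a b] /=.
by rewrite xpair_eqE andbC.
Qed.

Lemma perm_by_degree (s t : seq (nat * nat)) :
  (forall k, perm_eq (by_degree k s) (by_degree k t)) -> perm_eq s t.
Proof.
move=> st; apply/allP => -[k l] _ /=; apply/eqP.
by rewrite -!count_by_degree; exact/permP.
Qed.

Lemma ztensorE (t : ptype) : ztensor t = zblocks t.
Proof.
rewrite /zblocks -(@big_degrees _ _ _ t); last by move=> b; rewrite mem_undup.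
apply: eq_bigr => k _; rewrite /zpart.
have pm : perm_eq (undup (restr t k)) [seq b.2 | b <- undup t & b.1 == k].
  apply: uniq_perm; first exact: undup_uniq.
  - rewrite map_inj_in_uniq ?filter_uniq ?undup_uniq// => -[a b] [c d].
    by rewrite !mem_filter /= => /andP[/eqP -> _] /andP[/eqP -> _] ->.
  - move=> i; rewrite mem_undup /restr.
    by apply/mapP/mapP => -[b bt ->]; exists b => //;
      move: bt; rewrite !mem_filter mem_undup.
rewrite (perm_big _ pm) big_map big_filter; apply: eq_bigr => -[a b] /= /eqP <-.
by rewrite -[restr t a]/(by_degree a t) count_by_degree.
Qed.

Lemma zblocks_sup (r s : seq (nat * nat)) : uniq r -> {subset s <= r} ->
  zblocks s = (\prod_(b <- r) (b.2 ^ count_mem b s * (count_mem b s)`!))%N.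
Proof.
move=> ur sr; rewrite (bigID (mem s))/= [X in (_ * X)%N]big1 ?muln1; last first.
  by move=> b /count_memPn ->.
rewrite -big_filter; apply: perm_big; apply: uniq_perm.
- exact: undup_uniq.
- exact: filter_uniq.
- by move=> b; rewrite mem_undup mem_filter; case: (boolP (b \in s)) => // /sr.
Qed.

Lemma zblocks_perm (r s : seq (nat * nat)) : perm_eq r s ->
  zblocks r = zblocks s.
Proof.
move=> rs; rewrite (@zblocks_sup (undup s)) ?undup_uniq//.
  by apply: eq_bigr => b _; have /permP -> := rs.
by move=> b; rewrite mem_undup (perm_mem rs).
Qed.

(** Raising the multiplicity of [b = k^r] from [c] to [c + 1] multiplies
    [r^c c!] by [r (c + 1)]. *)
Lemma zblocks_cons b s :
  zblocks (b :: s) = (b.2 * (count_mem b s).+1 * zblocks s)%N.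
Proof.
have ur : uniq (undup (b :: s)) by exact: undup_uniq.
have br : b \in undup (b :: s) by rewrite mem_undup mem_head.
rewrite {1}/zblocks (@zblocks_sup _ s ur); last first.
  by move=> c; rewrite mem_undup inE orbC => ->.
rewrite !(bigD1_seq b br ur)/= eqxx add1n expnS factS.
rewrite (eq_bigr (fun c => c.2 ^ count_mem c s * (count_mem c s)`!)%N).
  by rewrite !mulnA; congr muln; nia.
by move=> c /negbTE cb; rewrite eq_sym cb add0n.
Qed.

(** * Exponential coefficients and their recursion *)

(** With [eps] the weight of a variable, this is the coefficient of
    [pow_sum k r] in the logarithm of the generating series, up to the factor
    [1 / r] that goes into [z]. *)
Definition log_sign (eps : rat) (r : nat) : rat := - (- eps) ^+ r.

Definition exp_coef (eps : rat) (s : seq (nat * nat)) : rat :=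
  (\prod_(b <- s) log_sign eps b.2) / (zblocks s)%:R.

Lemma exp_coef_perm eps s t : perm_eq s t -> exp_coef eps s = exp_coef eps t.
Proof. by move=> st; rewrite /exp_coef (zblocks_perm st) (perm_big _ st). Qed.

Lemma exp_coef_cons eps b s : (0 < b.2)%N ->
  (b.2 * (count_mem b s).+1)%:R * exp_coef eps (b :: s)
  = log_sign eps b.2 * exp_coef eps s.
Proof.
move=> b2; rewrite /exp_coef big_cons zblocks_cons.
set q := (b.2 * (count_mem b s).+1)%N.
have q0 : q%:R != 0 :> rat by rewrite pnatr_eq0 -lt0n muln_gt0 b2.
rewrite natrM invfM -!mulrA mulrCA; congr (_ * _).
by rewrite mulrCA; congr (_ * _); rewrite mulVKf.
Qed.

(** The coefficient of [t^d] in the exponential of the sum of all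
    [log_sign eps r / r *: pow_sum k r t^(k r)]. *)
Definition exp_part (eps : rat) (d : nat) : series :=
  \sum_(rho \in [set rho : ptype | rho ||- d]) exp_coef eps rho *: ptensor rho.

(** The blocks that can occur in a type of [d], listed to index finite sums
    over pairs [(k, r)]. *)
Definition small_blocks (d : nat) : seq (nat * nat) :=
  [seq b <- [seq (k, r) | k <- iota 1 d, r <- iota 1 d] | (b.1 * b.2 <= d)%N].

Lemma small_blocks_uniq d : uniq (small_blocks d).
Proof.
rewrite filter_uniq// allpairs_uniq ?iota_uniq//.
by move=> [? ?] [? ?] _ _ /= [-> ->].
Qed.

Lemma mem_small_blocks d b :
  (b \in small_blocks d) = [&& 0 < b.1, 0 < b.2 & b.1 * b.2 <= d]%N.
Proof.
case: b => k r; rewrite mem_filter andbC /= andbA.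
case: (leqP (k * r) d) => krd; rewrite ?andbF ?andbT//.
apply/allpairsP/andP => [[[a b] /= []]|[k0 r0]].
  by rewrite !mem_iota => ? ? [-> ->]; lia.
by exists (k, r); split => //=; rewrite mem_iota; nia.
Qed.

Lemma sum_count (V : nmodType) (T : eqType) (r s : seq T) (F : T -> V) :
  uniq r -> {subset s <= r} ->
  \sum_(x <- s) F x = \sum_(x <- r) F x *+ count_mem x s.
Proof.
move=> ur; elim: s => [|y s IHs] sr.
  by rewrite big_nil big1// => x _; rewrite mulr0n.
rewrite big_cons IHs; last by move=> x xs; rewrite sr// inE xs orbT.
have yr : y \in r by rewrite sr// mem_head.
rewrite !(bigD1_seq y yr ur)/= eqxx add1n mulrS -addrA; congr (_ + (_ + _)).
by apply: eq_bigr => x /negbTE xy; rewrite eq_sym xy add0n.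
Qed.

Lemma sub_small_blocks (t : ptype) d :
  t ||- d -> {subset blocks t <= small_blocks d}.
Proof.
move=> td b bt; rewrite mem_small_blocks.
have /allP/(_ b bt)/andP[-> ->] := ptype_positive t.
by rewrite -td /type_size (big_rem b)//= leq_addr.
Qed.

Lemma add_block_bij d b : b \in small_blocks d ->
  set_bij [set rho : ptype | rho ||- (d - b.1 * b.2)%N]
          [set rho : ptype | rho ||- d /\ b \in blocks rho]
          (fun rho : ptype => type_of (b :: rho)).
Proof.
rewrite mem_small_blocks => /and3P[b1 b2 bd].
have pos (rho : ptype) : positive_blocks (b :: rho).
  by rewrite /positive_blocks /= b1 b2; exact: ptype_positive.
split.
- move=> rho /= rhod; rewrite type_of_size// big_cons -/(type_size rho) rhod.
  by rewrite subnKC// (perm_mem (perm_type_of (pos rho))) mem_head.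
- move=> rho rho' _ _ e; apply: ptype_perm; rewrite -(perm_cons b).
  by rewrite -(permPl (perm_type_of (pos rho))) e; exact: perm_type_of.
- move=> rho /= [rhod brho]; have /permPl pr := perm_to_rem brho.
  have rpos : positive_blocks (rem b rho).
    have := ptype_positive rho.
    by rewrite /positive_blocks (perm_all _ (perm_to_rem brho)) => /andP[].
  exists (type_of (rem b rho)) => /=.
    rewrite type_of_size// -rhod /type_size [in RHS](perm_big _ (perm_to_rem brho)).
    by rewrite big_cons addKn.
  apply: ptype_perm; rewrite (permPl (perm_type_of (pos _))) perm_sym pr.
  by rewrite perm_cons perm_sym; exact: perm_type_of.
Qed.

Lemma exp_part0 eps : exp_part eps 0 = 1.
Proof.
rewrite /exp_part (_ : mkset _ = [set ptype0]); last first.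
  apply/seteqP; split => rho /=.
    move=> rho0; apply: ptype_perm.
    case: {2 3}(blocks rho) (erefl (blocks rho)) => //.
    move=> b s e; have := ptype_positive rho;
      rewrite e /= => /andP[/andP[b1 b2] _].
    by move: rho0; rewrite /type_size e big_cons; nia.
  by move=> ->; rewrite /type_size big_nil.
rewrite fsbig_set1 /exp_coef ptensorE /zblocks !big_nil.
by rewrite invr1 mulr1 scale1r.
Qed.

(** Write [d] as the sum of [k r c] over the distinct blocks [k^r] of [rho],
    with multiplicity [c].  For a fixed block, removing one copy of it from
    [rho] maps the types of [d] containing it onto the types of [d - k r], and
    the factor [r c] cancels against the quotient of the two values of [z]
    ([exp_coef_cons]), which leaves [k]. *)
Lemma exp_part_newton eps d : d%:R *: exp_part eps d =
  \sum_(b <- small_blocks d)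
    (b.1%:R * log_sign eps b.2) *:
      (pow_sum b.1 b.2 * exp_part eps (d - b.1 * b.2)).
Proof.
rewrite /exp_part !fsbig_finite; try exact: finite_types.
rewrite scaler_sumr.
(* [d] is the sum of [b.1 * b.2] over the blocks [b] of [rho]. *)
transitivity (\sum_(rho <- fset_set [set rho : ptype | rho ||- d])
   \sum_(b <- small_blocks d)
     (b.1 * b.2 * count_mem b (blocks rho))%:R
       *: (exp_coef eps rho *: ptensor rho)).
  rewrite big_seq [RHS]big_seq; apply: eq_bigr => rho.
  rewrite in_fset_set ?inE; last exact: finite_types.
  move=> rhod; rewrite -scaler_suml; congr (_ *: _).
  rewrite -natr_sum; congr (_%:R); rewrite -[LHS]rhod /type_size.
  rewrite (@sum_count nat _ (small_blocks d)) ?small_blocks_uniq//.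
    by apply: eq_bigr => b _; rewrite -mulr_natr natn.
  exact: sub_small_blocks.
rewrite exchange_big /= big_seq [RHS]big_seq; apply: eq_bigr => b bd.
have /and3P[b1 b2 bd'] : [&& 0 < b.1, 0 < b.2 & b.1 * b.2 <= d]%N.
  by rewrite -mem_small_blocks.
rewrite -!fsbig_finite; try exact: finite_types.
transitivity (\sum_(rho \in [set rho : ptype | rho ||- d /\ b \in blocks rho])
    (b.1 * b.2 * count_mem b (blocks rho))%:R
      *: (exp_coef eps rho *: ptensor rho)).
  apply/esym/fsbig_widen => [rho []//|rho [/= rhod rhob]].
  have /count_memPn -> : b \notin blocks rho by apply/negP => brho; apply: rhob.
  by rewrite muln0 scale0r.
rewrite (reindex_fsbig _ _ _ _ (add_block_bij bd)) !fsbig_finite;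
  try exact: finite_types.
rewrite mulr_sumr scaler_sumr; apply: eq_bigr => rho _.
have pos : positive_blocks (b :: rho).
  by rewrite /positive_blocks /= b1 b2; exact: ptype_positive.
have pt := perm_type_of pos.
rewrite (exp_coef_perm _ pt) !ptensorE (perm_big _ pt) big_cons.
have /permP -> := pt.
rewrite -scalerAr !scalerA /= eqxx add1n -mulnA natrM -!mulrA.
by rewrite exp_coef_cons.
Qed.

(** * Multiplication by a power sum *)

Definition vpow (v : var) (r : nat) : mon := expcmn (ucm v) r.

Lemma expcmnE (m : mon) n v : expcmn m n v = (m v * n)%N.
Proof.
case: n => [|n]; first by rewrite /expcmn /= muln0 onecmE.
rewrite /expcmn iteropS; elim: n => [|n IHn]; first by rewrite muln1.
by rewrite iterS mulcmE IHn [RHS]mulnS.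
Qed.

Lemma vpowE v r w : vpow v r w = ((v == w) * r)%N.
Proof. by rewrite /vpow expcmnE ucmE. Qed.

Lemma wdegE_sup (m : mon) (D : {fset var}) : {subset finsupp m <= D} ->
  wdeg m = (\sum_(v <- D) m v * vdeg v)%N.
Proof.
move=> /fsubsetP mD; rewrite /wdeg (big_fset_incl _ mD)// => v _.
by rewrite -cmE_eq0 => /eqP ->.
Qed.

Lemma wdegM (a b : mon) : wdeg (mmul a b) = (wdeg a + wdeg b)%N.
Proof.
rewrite (@wdegE_sup a (finsupp (mmul a b))).
  rewrite (@wdegE_sup b (finsupp (mmul a b))) -?big_split.
    by apply: eq_bigr => v _; rewrite cmM mulnDl.
  by move=> v; rewrite mdomD in_fsetU orbC => ->.
by move=> v; rewrite mdomD in_fsetU => ->.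
Qed.

Lemma wdeg_vpow v r : wdeg (vpow v r) = (vdeg v * r)%N.
Proof.
rewrite (@wdegE_sup _ [fset v]%fset) ?big_seq_fset1.
  by rewrite vpowE eqxx mul1n mulnC.
by move=> w; rewrite -cmE_neq0 vpowE in_fset1; case: (v =P w) => [->|].
Qed.

Lemma mul_vpowK (m : mon) v r : (r <= m v)%N ->
  mmul (vpow v r) (divcm m (vpow v r)) = m.
Proof.
move=> rm; apply/eqP/cmP => w; rewrite cmM divcmE vpowE.
by case: eqP => [<-|_]; rewrite ?mul1n ?mul0n ?subnKC// subn0.
Qed.

Lemma pow_sum_vpow v r : pow_sum (vdeg v) r (vpow v r) = 1.
Proof. by rewrite /pow_sum asboolT//; exists v. Qed.

Lemma vpow_inj r : (0 < r)%N -> injective (vpow^~ r).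
Proof.
move=> r0 v w /= /eqP/cmP/(_ v); rewrite !vpowE eqxx.
by case: eqP => [->//|_]; rewrite mul1n mul0n => r00; rewrite r00 in r0.
Qed.

Lemma series_sumE (I : Type) (s : seq I) (F : I -> series) m :
  (\sum_(i <- s) F i) m = \sum_(i <- s) F i m.
Proof. by elim/big_rec2: _ => // i x y _ <-. Qed.

Lemma smulE (f g : series) m :
  (f * g) m = \sum_(ab \in [set ab : mon * mon | mmul ab.1 ab.2 = m])
                f ab.1 * g ab.2.
Proof. by []. Qed.

(** Only the factorizations of [m] whose first factor is a pure power
    [x_v^r] contribute, and [x_v^r] determines the other factor. *)
Lemma pow_sum_mulE k r (f : series) m : (0 < r)%N ->
  (pow_sum k r * f) m =
  \sum_(v <- finsupp m | (vdeg v == k) && (r <= m v)%N) f (divcm m (vpow v r)).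
Proof.
move=> r0; pose S := [seq v <- finsupp m | (vdeg v == k) && (r <= m v)%N].
rewrite smulE -(@big_filter _ _ _ _ (enum_fset (finsupp m))) -/S.
pose h v := (vpow v r, divcm m (vpow v r)).
have hinj : set_inj [set` S] h by move=> v w _ _ [/vpow_inj -> //].
transitivity (\sum_(ab \in h @` [set` S]) pow_sum k r ab.1 * f ab.2);
  last first.
  rewrite fsbig_image// [RHS]fsbig_seq ?filter_uniq//; apply: eq_fsbigr => v.
  rewrite inE /= mem_filter => /andP[/andP[/eqP <- _] _].
  by rewrite pow_sum_vpow mul1r.
apply/esym/fsbig_widen.
  move=> ab [v] /=; rewrite mem_filter => /andP[/andP[_ rv] _] <- /=.
  exact: mul_vpowK.
move=> [a b] /= [abm nS]; rewrite /pow_sum; case: asboolP;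
  last by rewrite mul0r.
move=> [v [vk av]]; exfalso; apply: nS; exists v.
  have rv : (r <= m v)%N.
    by rewrite -abm av cmM [expcmn _ _ _]vpowE eqxx mul1n leq_addr.
  by rewrite /= mem_filter vk eqxx rv -cmE_neq0 -lt0n (leq_trans r0).
rewrite /h av -/(vpow v r); congr pair; apply: (@mmulI (vpow v r)).
rewrite -/(vpow v r) in av.
by rewrite mul_vpowK -?abm av// cmM vpowE eqxx mul1n leq_addr.
Qed.

(** * The recursion for square-free monomials *)

Definition sqfree_coef (eps : rat) (m : mon) : rat :=
  if squarefree m then eps ^+ size (finsupp m) else 0.

Definition E_deg (eps : rat) (d : nat) : series := fun m =>
  if wdeg m == d then sqfree_coef eps m else 0.

Lemma squarefreeP (m : mon) : reflect (forall v, (m v <= 1)%N) (squarefree m).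
Proof.
apply: (iffP allP) => [sq v|le1 v /=].
  by case: (mdomP m v) => // /sq /eqP ->.
by rewrite -cmE_neq0 -lt0n => m0; rewrite eqn_leq le1.
Qed.

Lemma sqfree_coef0 eps (m : mon) v : (1 < m v)%N -> sqfree_coef eps m = 0.
Proof.
by move=> mv; rewrite /sqfree_coef; case: squarefreeP => // /(_ v); lia.
Qed.

Lemma sqfree_coef_step eps (m : mon) v : m v = 1%N ->
  sqfree_coef eps m = eps * sqfree_coef eps (divcm m (vpow v 1)).
Proof.
move=> mv; rewrite /sqfree_coef.
have -> : squarefree (divcm m (vpow v 1)) = squarefree m.
  apply/squarefreeP/squarefreeP => sq w; have := sq w; rewrite divcmE vpowE.
    by case: eqP => [<-|_]; rewrite ?mv//; lia.
  by lia.
case: ifP; last by rewrite mulr0.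
have -> : finsupp (divcm m (vpow v 1)) = (finsupp m `\ v)%fset.
  apply/fsetP => w; rewrite in_fsetD1 -!cmE_neq0 divcmE vpowE [w == v]eq_sym.
  by case: (v =P w) => [<-|_]; rewrite ?mv// [(m w - _)%N]subn0.
have := cardfsD1 v (finsupp m); rewrite -cmE_neq0 mv add1n => sz.
by rewrite -exprS -[in RHS]sz.
Qed.

(** Let [e] be the exponent of [v].  A quotient of [m] by [x_v^r] can be
    square-free only for [r = e] and [r = e - 1].  If [e = 1], only [r = 1]
    occurs, and its term is the coefficient of [m].  If [e > 1], the coefficient
    of [m] is 0 and the two terms cancel: lowering [r] by one puts a factor
    [eps] in the coefficient of the quotient, raising it puts a factor [- eps]
    in the sign. *)
Lemma sqfree_coef_telescope eps (m : mon) v : v \in finsupp m ->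
  \sum_(r <- iota 1 (m v)) log_sign eps r * sqfree_coef eps (divcm m (vpow v r))
  = sqfree_coef eps m.
Proof.
rewrite -cmE_neq0; move mve : (m v) => [//|e] _.
case: e mve => [|e] mve.
  rewrite big_seq1 (sqfree_coef_step _ mve) /log_sign expr1 opprK//.
rewrite -addn2 iotaD big_cat/= big_cons big_seq1 add1n.
rewrite big1_seq => [|r /andP[_]]; last first.
  rewrite mem_iota => re; rewrite (@sqfree_coef0 _ _ v) ?mulr0//.
  by rewrite divcmE vpowE eqxx; lia.
rewrite [RHS](@sqfree_coef0 _ _ v) ?mve// add0r.
have mv1 : divcm m (vpow v e.+1) v = 1%N.
  by rewrite divcmE vpowE eqxx; lia.
rewrite (sqfree_coef_step _ mv1).
have -> : divcm (divcm m (vpow v e.+1)) (vpow v 1) = divcm m (vpow v e.+2).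
  apply/eqP/cmP => w; rewrite !divcmE !vpowE.
  by case: eqP; lia.
by rewrite /log_sign [X in _ + - X * _]exprS; ring.
Qed.

(** At a monomial [m] of degree [d], the right-hand side is a sum over the
    variables [v] of [m] and the exponents [r] up to [m v]; the sum over [r]
    telescopes to the coefficient of [m], and if [m] is square-free the degrees
    of its variables add up to [d]. *)
Lemma E_deg_newton eps d : d%:R *: E_deg eps d =
  \sum_(b <- small_blocks d)
    (b.1%:R * log_sign eps b.2) *:
      (pow_sum b.1 b.2 * E_deg eps (d - b.1 * b.2)).
Proof.
apply/funext => m.
rewrite series_sumE [LHS](_ : _ = d%:R * E_deg eps d m)//.
transitivity (\sum_(b <- small_blocks d)
    \sum_(v <- finsupp m | (vdeg v == b.1) && (b.2 <= m v)%N)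
      if wdeg m == d
      then (vdeg v)%:R
           * (log_sign eps b.2 * sqfree_coef eps (divcm m (vpow v b.2)))
      else 0); last first.
  rewrite big_seq [RHS]big_seq; apply: eq_bigr => -[k r] /=.
  rewrite mem_small_blocks /= => /and3P[k0 r0 krd].
  rewrite [RHS](_ : _ = (k%:R * log_sign eps r)
    * (pow_sum k r * E_deg eps (d - k * r)%N) m)//.
  rewrite pow_sum_mulE// mulr_sumr; apply: eq_bigr => v /andP[/eqP vk rv].
  have -> : (wdeg m == d) = (wdeg (divcm m (vpow v r)) == d - k * r)%N.
    rewrite -[in LHS](mul_vpowK rv) wdegM wdeg_vpow vk.
    by rewrite -[in LHS](subnKC krd) eqn_add2l.
  by rewrite /E_deg vk; case: ifP; rewrite ?mulr0 // mulrA.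
rewrite (exchange_big_dep xpredT)//= /E_deg.
case: eqP => [md|_]; last first.
  by rewrite mulr0 big1// => v _; rewrite big1.
transitivity (\sum_(v <- finsupp m) (vdeg v)%:R * sqfree_coef eps m);
  last first.
  rewrite big_seq [RHS]big_seq; apply: eq_bigr => v vm.
  rewrite -mulr_sumr; congr (_ * _).
  rewrite -(sqfree_coef_telescope _ vm) -[RHS]big_filter.
  rewrite -[LHS](big_map (pair (vdeg v)) xpredT
    (fun b => log_sign eps b.2 * sqfree_coef eps (divcm m (vpow v b.2)))).
  apply/esym/perm_big/uniq_perm.
  - by rewrite filter_uniq// small_blocks_uniq.
  - by rewrite map_inj_uniq ?iota_uniq// => ? ? [].
  - move=> [k r]; rewrite mem_filter mem_small_blocks /=.
    have v0 : (0 < vdeg v)%N by have /andP[] := valP v.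
    apply/idP/mapP => [/andP[/andP[/eqP <- rm] /and3P[_ r0 _]]|[r' rm' [-> ->]]].
      by exists r => //; rewrite mem_iota r0 add1n ltnS.
    move: rm'; rewrite mem_iota add1n ltnS => /andP[r0 rm].
    rewrite eqxx rm v0 r0 /= -md /wdeg (big_fsetD1 v)//=.
    by rewrite mulnC (leq_trans _ (leq_addr _ _))// leq_mul2r rm orbT.
rewrite -mulr_suml -natr_sum /sqfree_coef.
case: squarefreeP => [sq|_]; last by rewrite !mulr0.
congr (_%:R * _); rewrite -md /wdeg big_seq [RHS]big_seq; apply: eq_bigr => v.
by rewrite -cmE_neq0; have := sq v; case: (m v) => [//|[|//]] _ _;
  rewrite mul1n.
Qed.

Lemma E_deg0 eps : E_deg eps 0 = 1.
Proof.
apply/funext => m; rewrite /E_deg [RHS](_ : _ = (m == mone)%:R)//.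
case: (m =P mone) => [->|m1].
  rewrite /wdeg mdom1 big_seq_fset0 eqxx /sqfree_coef /squarefree mdom1.
  by rewrite (_ : size _ = 0%N)// cardfs0.
rewrite ifN//; apply/eqP => w0; apply: m1; apply/eqP/cmP => v; rewrite cm1.
move: w0; rewrite /wdeg; case: (mdomP m v) => // vm.
rewrite (big_fsetD1 v)//=.
have v0 : (0 < vdeg v)%N by have /andP[] := valP v.
nia.
Qed.

Lemma E_deg_exp_part eps d : E_deg eps d = exp_part eps d.
Proof.
elim/ltn_ind: d => -[|d] IHd; first by rewrite E_deg0 exp_part0.
have d0 : d.+1%:R != 0 :> rat by rewrite pnatr_eq0.
apply: (scalerI d0); rewrite E_deg_newton exp_part_newton.
rewrite big_seq [RHS]big_seq; apply: eq_bigr => -[k r].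
rewrite mem_small_blocks /= => /and3P[k0 r0 krd]; rewrite IHd//.
by nia.
Qed.

Lemma Eplus_degE d : Eplus_deg d = E_deg 1 d.
Proof.
apply/funext => m; rewrite /Eplus_deg /E_deg /sqfree_coef expr1n.
by case: (squarefree m); case: (wdeg m == d).
Qed.

Lemma Eminus_degE d : Eminus_deg d = E_deg (-1) d.
Proof.
apply/funext => m; rewrite /Eminus_deg /E_deg /sqfree_coef.
by case: (squarefree m); case: (wdeg m == d).
Qed.

(** * Raising the variables to a power *)

Lemma expcmn_inj r : (0 < r)%N -> injective (fun u : mon => expcmn u r : mon).
Proof.
move=> r0 u w /= /eqP/cmP uw; apply/eqP/cmP => v; have := uw v.
by rewrite !expcmnE => /eqP; rewrite eqn_pmul2r// => /eqP.
Qed.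

Lemma expcmnM r (a b : mon) :
  expcmn (mmul a b) r = mmul (expcmn a r : mon) (expcmn b r).
Proof. by apply/eqP/cmP => v; rewrite expcmnE !cmM !expcmnE mulnDl. Qed.

Lemma subst_pow_exp r (f : series) u : (0 < r)%N ->
  subst_pow r f (expcmn u r) = f u.
Proof.
move=> r0; rewrite /subst_pow (_ : mkset _ = [set u]) ?fsbig_set1//.
by apply/seteqP; split=> w /=; [exact: expcmn_inj | move=> ->].
Qed.

Lemma subst_pow_noroot r (f : series) m :
  (forall u : mon, expcmn u r <> m) -> subst_pow r f m = 0.
Proof. by move=> nr; rewrite /subst_pow fsbig1// => u /nr. Qed.

(** Coefficients of [subst_pow r f] are computed by this dichotomy: they are
    those of [f] at [r]-th powers and 0 elsewhere. *)
Lemma root_spec r (m : mon) :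
  (exists u : mon, m = expcmn u r) \/ (forall u : mon, expcmn u r <> m).
Proof.
have [[u ->]|nr] := pselect (exists u : mon, m = expcmn u r); first by left;
  exists u.
by right=> u um; apply: nr; exists u.
Qed.

Lemma subst_pow_linear r a (f g : series) : (0 < r)%N ->
  subst_pow r (a *: f + g) = a *: subst_pow r f + subst_pow r g.
Proof.
move=> r0; apply/funext => m.
rewrite [RHS](_ : _ = a * subst_pow r f m + subst_pow r g m)//.
have [[u ->]|nr] := root_spec r m; first by rewrite !subst_pow_exp.
by rewrite !subst_pow_noroot// mulr0 addr0.
Qed.

Lemma subst_pow_sum r (I : Type) (s : seq I) (a : I -> rat) (F : I -> series) :
  (0 < r)%N ->
  subst_pow r (\sum_(i <- s) a i *: F i) = \sum_(i <- s) a i *: subst_pow r (F i).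
Proof.
move=> r0; elim: s => [|i s IHs];
  last by rewrite !big_cons subst_pow_linear// IHs.
rewrite !big_nil; apply/funext => m; rewrite /subst_pow fsbig1//.
Qed.

Lemma subst_pow1 r : (0 < r)%N -> subst_pow r 1 = 1.
Proof.
move=> r0; apply/funext => m; rewrite [RHS](_ : _ = (m == mone)%:R)//.
have e1 : expcmn mone r = mone :> mon by apply/eqP/cmP => v;
  rewrite expcmnE !cm1.
have [[u ->]|nr] := root_spec r m.
  rewrite subst_pow_exp// [LHS](_ : _ = (u == mone)%:R)//;
    congr ((_ : bool)%:R).
  by apply/eqP/eqP => [->|u1] //; apply: (expcmn_inj r0); rewrite /= u1 e1.
by rewrite subst_pow_noroot//; case: eqP => // m1; case: (nr mone); rewrite e1.
Qed.

(** A factorization of [u^r] into two [r]-th powers is the [r]-th power of a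
    factorization of [u]; the other factorizations of a monomial contribute
    0. *)
Lemma subst_powM r (f g : series) : (0 < r)%N ->
  subst_pow r (f * g) = subst_pow r f * subst_pow r g.
Proof.
move=> r0; apply/funext => m; rewrite [RHS]smulE.
pose h (ab : mon * mon) : mon * mon := (expcmn ab.1 r, expcmn ab.2 r).
have hinj (S : set (mon * mon)) : set_inj S h.
  by move=> [a b] [c d] _ _ [/(expcmn_inj r0) -> /(expcmn_inj r0) ->].
have hE (S : set (mon * mon)) :
    \sum_(ab \in h @` S) subst_pow r f ab.1 * subst_pow r g ab.2
    = \sum_(ab \in S) f ab.1 * g ab.2.
  by rewrite fsbig_image//; apply: eq_fsbigr => ab _; rewrite !subst_pow_exp.
have out ab : (forall c, h c <> ab) ->
    subst_pow r f ab.1 * subst_pow r g ab.2 = 0.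
  case: ab => a b /= nr.
  have [[u ua]|na] := root_spec r a; last by rewrite subst_pow_noroot ?mul0r.
  have [[w wb]|nb] := root_spec r b;
    last by rewrite mulrC subst_pow_noroot ?mul0r.
  by case: (nr (u, w)); rewrite /h -ua -wb.
have [[u ->]|nr] := root_spec r m.
  rewrite subst_pow_exp// smulE -hE; apply: fsbig_widen.
    by move=> _ [[a b] /= <- <-] /=; rewrite expcmnM.
  move=> ab /= [abu nim]; apply: out => c hc; apply: nim; exists c => //=.
  by apply: (expcmn_inj r0); rewrite /= expcmnM -abu -hc.
rewrite subst_pow_noroot// fsbig1// => ab abm; apply: out => c hc.
by case: (nr (mmul c.1 c.2)); rewrite expcmnM -abm -hc.
Qed.

Lemma subst_pow_prod r (I : Type) (s : seq I) (F : I -> series) : (0 < r)%N ->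
  subst_pow r (\prod_(i <- s) F i) = \prod_(i <- s) subst_pow r (F i).
Proof.
move=> r0; apply: (big_morph _ (fun f g => subst_powM f g r0)).
exact: subst_pow1.
Qed.

Lemma subst_pow_sum_var r k q : (0 < r)%N ->
  subst_pow r (pow_sum k q) = pow_sum k (r * q).
Proof.
move=> r0; apply/funext => m.
have ve v : expcmn (vpow v q) r = vpow v (r * q).
  by apply/eqP/cmP => w; rewrite expcmnE !vpowE; lia.
have [[u ->]|nr] := root_spec r m.
  rewrite subst_pow_exp// /pow_sum; congr ((nat_of_bool _)%:R).
  apply/asboolP/asboolP => -[v [vk e]]; exists v; split=> //.
    by rewrite e -/(vpow v q) ve.
  by apply: (expcmn_inj r0); rewrite /= -/(vpow v q) ve.
rewrite subst_pow_noroot// /pow_sum; case: asboolP => // -[v [vk e]].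
by case: (nr (vpow v q)); rewrite ve.
Qed.

(** * Linear independence of the products of power sums *)

Lemma pow_sum_ge0 k r m : 0 <= pow_sum k r m.
Proof. exact: ler0n. Qed.

Lemma smul_ge0 (f g : series) : (forall m, 0 <= f m) -> (forall m, 0 <= g m) ->
  forall m, 0 <= (f * g) m.
Proof.
by move=> f0 g0 m; rewrite smulE fsumr_ge0// => ab _; rewrite mulr_ge0.
Qed.

Lemma smul_ge (f g : series) a b :
  (forall m, 0 <= f m) -> (forall m, 0 <= g m) ->
  f a * g b <= (f * g) (mmul a b).
Proof.
move=> f0 g0; rewrite smulE (fsbigD1 (a, b))//=;
  last exact: finite_factorizations.
by rewrite lerDl fsumr_ge0// => ab _; rewrite mulr_ge0.
Qed.

Lemma smul_neq0 (f g : series) m : (f * g) m != 0 ->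
  exists a b, [/\ mmul a b = m, f a != 0 & g b != 0].
Proof.
rewrite smulE => /(@fsbigN1 _ _ _ unit _ _ (fun _ ab => f ab.1 * g ab.2) tt).
by move=> [[a b] /= abm]; rewrite mulf_eq0 negb_or => /andP[]; exists a, b.
Qed.

(** Regarded as a multiset of blocks, this is the type with fewest blocks
    among those whose product of power sums contains [m]. *)
Definition profile (m : mon) : seq (nat * nat) :=
  [seq (vdeg v, m v) | v <- finsupp m].

Lemma finsupp_vpowM v r (m : mon) : (0 < r)%N ->
  finsupp (mmul (vpow v r) m) = (v |` finsupp m)%fset.
Proof.
move=> r0; rewrite mdomD; congr fsetU; apply/fsetP => w.
rewrite in_fset1 -cmE_neq0 vpowE [w == v]eq_sym.
by case: (v == w); rewrite ?mul1n -?lt0n ?r0.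
Qed.

Lemma profile_vpowM v r (m : mon) : (0 < r)%N -> v \notin finsupp m ->
  perm_eq (profile (mmul (vpow v r) m)) ((vdeg v, r) :: profile m).
Proof.
move=> r0 vm; have := cmE_eq0 m v; rewrite vm => /eqP mv.
rewrite /profile finsupp_vpowM//.
have -> : (vdeg v, r) :: [seq (vdeg w, m w) | w <- finsupp m] =
    [seq (vdeg w, mmul (vpow v r) m w) | w <- v :: enum_fset (finsupp m)].
  rewrite /= cmM vpowE eqxx mv mul1n addn0; congr cons.
  apply/eq_in_map => w wm; rewrite cmM vpowE.
  by case: eqP => // vw; rewrite vw wm in vm.
apply: perm_map; apply: uniq_perm; rewrite ?fset_uniq//=.
  by rewrite vm fset_uniq.
by move=> w; rewrite in_fsetU in_fset1 inE.
Qed.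

(** A monomial of the product chooses one variable for each block; it has as
    many variables as there are blocks only if the choices are distinct, and
    then the exponents are the multiplicities of the blocks. *)
Lemma prod_pow_sum_supp (s : seq (nat * nat)) (m : mon) : positive_blocks s ->
  (\prod_(b <- s) pow_sum b.1 b.2) m != 0 ->
  (size (profile m) <= size s)%N /\
  (size (profile m) = size s -> perm_eq (profile m) s).
Proof.
elim: s m => [|[k r] s IHs] m /=.
  rewrite big_nil [X in X != 0](_ : _ = (m == mone)%:R)//.
  by case: (m =P mone) => [->|_]; rewrite ?eqxx// => _ _;
    rewrite /profile mdom1.
move=> /andP[/andP[/= k0 r0] /IHs {}IHs]; rewrite big_cons.
move=> /smul_neq0[a [b [<- ]]] /=; rewrite /pow_sum;
  case: asboolP => // -[v [vk ->]] _.
move=> /IHs[le eq]; rewrite -/(vpow v r).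
have [vb|vb] := boolP (v \in finsupp b).
  have -> : size (profile (mmul (vpow v r) b)) = size (profile b).
    rewrite !size_map finsupp_vpowM//; congr (size (enum_fset _)).
    by apply/fsetP => w; rewrite in_fsetU in_fset1; case: eqP => // ->.
  by split; [exact: leqW|lia].
have /perm_size sz := profile_vpowM r0 vb.
rewrite sz; split=> //= -[/eq be].
by rewrite (perm_trans (profile_vpowM r0 vb))// vk perm_cons.
Qed.

Lemma fresh_var k (m : mon) : (0 < k)%N ->
  exists v : var, vdeg v = k /\ v \notin finsupp m.
Proof.
(* The second index [j] exceeds that of every variable of [m]. *)
move=> k0; pose j := (\max_(v <- finsupp m) (val v).2).+1.
have kj : ((0 < (k, j).1) && (0 < (k, j).2))%N by rewrite k0.
exists (Sub (k, j) kj : var); split; first by rewrite /vdeg SubK.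
apply/negP => vm; have := @leq_bigmax_seq _ (enum_fset (finsupp m)) xpredT
  (fun v : var => (val v).2) _ vm isT.
by rewrite SubK /= ltnn.
Qed.

(** Choose a new variable for each block; no cancellation can occur since all
    coefficients are nonnegative. *)
Lemma prod_pow_sum_witness (s : seq (nat * nat)) : positive_blocks s ->
  exists m, perm_eq (profile m) s /\ 0 < (\prod_(b <- s) pow_sum b.1 b.2) m.
Proof.
elim: s => [_|[k r] s IHs /= /andP[/andP[/= k0 r0] /IHs[m [pm m0]]]].
  exists mone; rewrite /profile mdom1 big_nil.
  by rewrite [X in 0 < X](_ : _ = (mone == mone :> mon)%:R)// eqxx.
have [v [vk vm]] := fresh_var m k0.
exists (mmul (vpow v r) m); split.
  by rewrite (perm_trans (profile_vpowM r0 vm))// vk perm_cons.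
rewrite big_cons; apply: lt_le_trans (smul_ge _ _ _ _).
- by rewrite /= -vk pow_sum_vpow mul1r.
- exact: pow_sum_ge0.
- elim/big_rec: _ => [w|b f _ f0]; first exact: ler0n.
  by apply: smul_ge0 => // w; exact: pow_sum_ge0.
Qed.

Lemma size_ptype (t : ptype) n : t ||- n -> (size t <= n)%N.
Proof.
move=> <-; rewrite /type_size -sum1_size big_seq [leqRHS]big_seq.
apply: leq_sum => b bt; have /allP/(_ b bt)/andP[b1 b2] := ptype_positive t.
by rewrite muln_gt0 b1.
Qed.

(** The coefficients [c t] vanish by induction, the types with more blocks
    first: the monomial attached to [t] isolates [c t] once those of the longer
    types are known to be 0. *)
Lemma ptensor_free n (c : ptype -> rat) :
  \sum_(t \in [set t : ptype | t ||- n]) c t *: ptensor t = 0 ->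
  forall t, t ||- n -> c t = 0.
Proof.
move=> c0 t; have [k] := ubnP (n - size t); elim: k t => // k IHk t tk tn.
have [m [pm m0]] := prod_pow_sum_witness (ptype_positive t).
have := congr1 (fun f : series => f m) c0.
rewrite fsbig_finite; last exact: finite_types.
rewrite series_sumE -fsbig_finite; last exact: finite_types.
rewrite (fsbigD1 t)//=; last exact: finite_types.
rewrite fsbig1 => [|u [/= un ut]].
  rewrite addr0 ptensorE => /eqP.
  rewrite [X in X == _](_ : _ = c t * (\prod_(b <- t) pow_sum b.1 b.2) m)//.
  by rewrite mulf_eq0 (gt_eqF m0) orbF => /eqP.
rewrite [LHS](_ : _ = c u * ptensor u m)// ptensorE.
have [ltu|leu] := ltnP (size t) (size u).
  by rewrite IHk ?mul0r//; have := size_ptype un; lia.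
apply/eqP; rewrite mulf_eq0; apply/orP; right;
  apply: contraT => /prod_pow_sum_supp.
move=> /(_ (ptype_positive u))[]; rewrite (perm_size pm) => le eq; case: ut.
apply: ptype_perm; rewrite perm_sym -(permPl pm); apply: eq.
by apply/eqP; rewrite eqn_leq le.
Qed.

(** * Expansion of a product of dilated sums *)

Lemma finite_dep_ffun (n : nat) (I : choiceType) (A : 'I_n -> set I) :
  (forall i, finite_set (A i)) ->
  finite_set [set f : {ffun 'I_n -> I} | forall i, A i (f i)].
Proof.
move=> fA; pose D : {fset I} := fset_set (\bigcup_(i in [set: 'I_n]) A i).
have memD i x : A i x -> x \in D.
  by move=> Ax; rewrite in_fset_set ?inE; [exists i|exact: bigcup_finite].
pose h (g : {ffun 'I_n -> D}) : {ffun 'I_n -> I} := [ffun i => val (g i)].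
apply: (@sub_finite_set _ _ (h @` [set: {ffun 'I_n -> D}])); last first.
  exact/finite_image/finite_finset.
move=> f /= fP; exists [ffun i => [` memD i (f i) (fP i)]%fset] => //.
by apply/ffunP => i; rewrite !ffunE.
Qed.

(** Distributivity over finite subsets [A i] of an infinite type: all
    [A i] are embedded in the finite type of the elements of their union. *)
Lemma prod_fsbig (R : comNzRingType) (n : nat) (I : choiceType)
    (A : 'I_n -> set I) (F : 'I_n -> I -> R) :
  (forall i, finite_set (A i)) ->
  \prod_(i < n) \sum_(x \in A i) F i x =
  \sum_(f \in [set f : {ffun 'I_n -> I} | forall i, A i (f i)])
    \prod_(i < n) F i (f i).
Proof.
move=> fA; pose D : {fset I} := fset_set (\bigcup_(i in [set: 'I_n]) A i).
have memD i x : A i x -> x \in D.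
  by move=> Ax; rewrite in_fset_set ?inE; [exists i|exact: bigcup_finite].
pose Q i : pred D := fun x => `[< A i (val x) >].
transitivity (\prod_(i < n) \sum_(x : D | Q i x) F i (val x)).
  apply: eq_bigr => i _; rewrite (@bigfs _ _ _ _ (index_enum D))//;
    last 2 first.
  - exact: index_enum_uniq.
  - by move=> x _; rewrite mem_index_enum.
  apply: reindex_fsbig; split => [x /= /asboolP//|x y _ _ /val_inj//|x Ax].
  by exists [` memD i x Ax]%fset => //=; apply/asboolP.
rewrite bigA_distr_big_dep (@bigfs _ _ _ _ (index_enum _))//; last 2 first.
- exact: index_enum_uniq.
- by move=> f _; rewrite mem_index_enum.
pose h (g : {ffun 'I_n -> D}) : {ffun 'I_n -> I} := [ffun i => val (g i)].
rewrite [RHS](reindex_fsbig h [set` family Q]).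
  by apply: eq_fsbigr => f _; apply: eq_bigr => i _; rewrite ffunE.
split => [f /= /familyP fQ i|f g _ _ /ffunP fg|f fP].
- by rewrite ffunE; exact/asboolP/fQ.
- by apply/ffunP => i; apply: val_inj; have := fg i; rewrite !ffunE.
- exists [ffun i => [` memD i (f i) (fP i)]%fset].
    by apply/familyP => i; rewrite ffunE; apply/asboolP => /=; exact: fP.
  by apply/ffunP => i; rewrite !ffunE.
Qed.

Lemma fsbig_fibers (V : nmodType) (I J : choiceType) (A : set I) (B : set J)
    (h : I -> J) (F : I -> V) :
  finite_set A -> finite_set B -> (forall x, A x -> B (h x)) ->
  \sum_(x \in A) F x = \sum_(y \in B) \sum_(x \in [set x | A x /\ h x = y]) F x.
Proof.
move=> fA fB AB;
  transitivity (\sum_(y \in B) \sum_(x \in A) if h x == y then F x else 0).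
  rewrite exchange_fsbig//; apply: eq_fsbigr => x; rewrite inE => /AB Bhx.
  rewrite (fsbigD1 (h x))//= eqxx fsbig1 ?addr0// => y [_ /= yhx].
  by case: eqP => // hxy; case: yhx.
apply: eq_fsbigr => y _;
  rewrite -(@fsbig_widen _ _ _ _ [set x | A x /\ h x = y] A).
- by apply: eq_fsbigr => x; rewrite inE => -[_ ->]; rewrite eqxx.
- by move=> x [].
- by move=> x [Ax /= nx]; case: eqP => // hx; case: nx.
Qed.

Definition E_type (eps : rat) (sigma : ptype) : series :=
  \prod_(b <- blocks sigma) subst_pow b.2 (E_deg eps b.1).

(** The union of the [m_i f(i)], where [sigma] has blocks [d_i^m_i]. *)
Definition dilated (sigma : ptype) (f : {ffun 'I_(size sigma) -> ptype}) :
    seq (nat * nat) :=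
  flatten [seq [seq (b.1, (block_of i).2 * b.2)%N | b <- blocks (f i)]
          | i <- enum 'I_(size sigma)].

Lemma block_of_gt0 (sigma : ptype) (i : 'I_(size sigma)) :
  (0 < (block_of i).1)%N && (0 < (block_of i).2)%N.
Proof.
have /allP := ptype_positive sigma; apply.
by rewrite /block_of mem_tnth.
Qed.

Lemma dilated_positive (sigma : ptype) f : positive_blocks (@dilated sigma f).
Proof.
apply/allP => c /flatten_mapP[i _ /mapP[b bf ->]] /=.
have /allP/(_ b bf)/andP[-> b2] := ptype_positive (f i).
by have /andP[_ m0] := block_of_gt0 i; rewrite muln_gt0 m0.
Qed.

Definition summand_types (sigma : ptype) :
    set {ffun 'I_(size sigma) -> ptype} :=
  [set f | forall i, f i ||- (block_of i).1].

Arguments summand_types : clear implicits.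

Lemma type_of_dilated_size (sigma : ptype) f n : sigma ||- n ->
  summand_types sigma f -> type_of (dilated f) ||- n.
Proof.
move=> <- fP; rewrite type_of_size; last exact: dilated_positive.
rewrite /dilated big_flatten big_map big_enum /type_size.
rewrite [RHS](big_tnth _ _ (blocks sigma)); apply: eq_bigr => i _.
rewrite big_map -[tnth _ _]/(block_of i) -(fP i) mulnC big_distrr.
by apply: eq_bigr => b _ /=; rewrite mulnCA.
Qed.

Lemma subst_pow_E_deg eps m d : (0 < m)%N ->
  subst_pow m (E_deg eps d) = \sum_(rho \in [set rho : ptype | rho ||- d])
    exp_coef eps rho *: \prod_(b <- rho) pow_sum b.1 (m * b.2).
Proof.
move=> m0; rewrite E_deg_exp_part /exp_part !fsbig_finite;
  try exact: finite_types.
rewrite subst_pow_sum//; apply: eq_bigr => rho _;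
  rewrite ptensorE subst_pow_prod//.
by under eq_bigr do rewrite subst_pow_sum_var//.
Qed.

(** Distribute the product over the blocks of [sigma]; a product of dilated
    power sums is again a [ptensor]. *)
Lemma E_type_expand eps (sigma : ptype) : E_type eps sigma =
  \sum_(f \in summand_types sigma)
    (\prod_(i < size sigma) exp_coef eps (f i)) *: ptensor (type_of (dilated f)).
Proof.
rewrite /E_type (big_tnth _ _ (blocks sigma)).
under eq_bigr => i _.
  rewrite subst_pow_E_deg; last by have /andP[] := block_of_gt0 i.
  over.
rewrite (@prod_fsbig _ _ _ (fun i : 'I_(size sigma) =>
  [set rho : ptype | rho ||- (block_of i).1])).
  apply: eq_fsbigr => f _; rewrite scaler_prod; congr (_ *: _).
  rewrite ptensorE (perm_big _ (perm_type_of (dilated_positive f))).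
  rewrite /dilated big_flatten big_map big_enum.
  by apply: eq_bigr => i _; rewrite big_map.
by move=> i; exact: finite_types.
Qed.

Lemma E_type_transition eps n (sigma : ptype) : sigma ||- n ->
  E_type eps sigma = \sum_(tau \in [set tau : ptype | tau ||- n])
    (\sum_(f \in [set f | summand_types sigma f /\ type_of (dilated f) = tau])
      \prod_(i < size sigma) exp_coef eps (f i)) *: ptensor tau.
Proof.
move=> sn; have fS : finite_set (summand_types sigma).
  by apply: (@finite_dep_ffun _ _ (fun i => [set rho | rho ||- (block_of i).1]));
    move=> i; exact: finite_types.
rewrite E_type_expand (@fsbig_fibers _ _ _ _ [set tau : ptype | tau ||- n]
  (fun f => type_of (dilated f)))//; last 2 first.
- exact: finite_types.
- by move=> f; exact: type_of_dilated_size.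
apply: eq_fsbigr => tau _.
have fF : finite_set [set f | summand_types sigma f /\ type_of (dilated f) = tau].
  by apply: sub_finite_set fS => f [].
rewrite !fsbig_finite// scaler_suml big_seq [RHS]big_seq; apply: eq_bigr => f.
by rewrite in_fset_set// inE => -[_ ->].
Qed.

(** * Tableaux and families of types *)

(** Pairs are (length of a row, label), and this keeps the lengths of the
    rows labelled [i]. *)
Definition with_label (i : nat) (s : seq (nat * nat)) : seq nat :=
  [seq x.1 | x <- s & x.2 == i].

Lemma perm_with_label (n : nat) (s t : seq (nat * nat)) :
  all (fun x => x.2 < n)%N s -> all (fun x => x.2 < n)%N t ->
  (forall i : 'I_n, perm_eq (with_label i s) (with_label i t)) -> perm_eq s t.
Proof.
move=> sn tn st; apply/allP => -[l i] lis /=; apply/eqP.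
have e (u : seq (nat * nat)) : count_mem (l, i) u = count_mem l (with_label i u).
  rewrite count_map count_filter; apply: eq_count => -[a b] /=.
  by rewrite xpair_eqE.
have /= ltin : ((l, i).2 < n)%N.
  by move: lis; rewrite mem_cat => /orP[/(allP sn)|/(allP tn)].
by rewrite !e; exact/permP/(st (Ordinal ltin)).
Qed.

(** Longer rows come first and rows of equal length are ordered by label:
    the lists of rows sorted for this order are those of increasing tableaux. *)
Definition label_le (x y : nat * nat) : bool :=
  (y.1 < x.1)%N || (x.1 == y.1) && (x.2 <= y.2)%N.

Lemma label_le_trans : transitive label_le.
Proof. by move=> [a b] [c d] [e f]; rewrite /label_le /=; lia. Qed.

Lemma label_le_anti : antisymmetric label_le.
Proof. by move=> [a b] [c d]; rewrite /label_le /= => ?; congr pair; lia. Qed.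

Lemma label_le_total : total label_le.
Proof. by move=> [a b] [c d]; rewrite /label_le /=; lia. Qed.

Lemma label_le_refl : reflexive label_le.
Proof. by move=> [a b]; rewrite /label_le /=; lia. Qed.

Lemma restr_sorted (t : ptype) k : sorted geq (restr t k).
Proof.
have /andP[_ st] := blocksP t.
rewrite /restr sorted_map.
apply: (@sub_in_sorted _ (fun b => b.1 == k) block_ge).
- move=> [a b] [c d] /eqP /= -> /eqP /= ->.
  by rewrite /block_ge /= ltnn eqxx.
- by apply/allP => b; rewrite mem_filter => /andP[].
- exact: sorted_filter block_ge_trans _ _ st.
Qed.

Lemma restr_gt0 (t : ptype) k l : l \in restr t k -> (0 < l)%N.
Proof.
move=> /mapP[b]; rewrite mem_filter => /andP[_ bt] ->.
by have /allP/(_ b bt)/andP[] := ptype_positive t.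
Qed.

Lemma mem_rows (t : ptype) k r :
  ((k, r) \in rows t) = (r < size (restr t k))%N.
Proof.
apply/allpairsPdep/idP => [[k' [r' [_ + [-> ->]]]]|rk];
  first by rewrite mem_iota.
exists k, r; split=> //; last by rewrite mem_iota.
rewrite mem_undup;
  have /mapP[b] : nth 0%N (restr t k) r \in restr t k by rewrite mem_nth.
by rewrite mem_filter => /andP[/eqP <- bt] _; exact: map_f.
Qed.

Lemma cell_row_mem (t : ptype) (x : cell t) :
  ((cell_row x).2 < size (restr t (cell_row x).1))%N.
Proof.
rewrite -mem_rows -surjective_pairing /cell_row.
by have /allpairsPdep[kr [c [kr_in _ ->]]] := ssvalP x.
Qed.

Lemma row_has_cell (t : ptype) k r : (r < size (restr t k))%N ->
  exists x : cell t, cell_row x = (k, r) /\ cell_col x = 0%N.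
Proof.
move=> rk; have xin : ((k, r), 0%N) \in cells t.
  apply/allpairsPdep; exists (k, r), 0%N; split=> //; first by rewrite mem_rows.
  by rewrite mem_iota /= add0n; apply: (@restr_gt0 t k); rewrite mem_nth.
by exists (SeqSub xin).
Qed.

(** The common entry of the row [kr]; rows of length 0 do not occur, so the
    value 0 is only taken outside the diagram. *)
Definition entry (tau sigma : ptype) (T : filling tau sigma)
    (kr : nat * nat) : nat :=
  if [pick x : cell tau | cell_row x == kr] is Some x then T x else 0%N.

Definition labelled_rows (tau sigma : ptype) (T : filling tau sigma) (k : nat) :
    seq (nat * nat) :=
  [seq (row_len tau (k, r), entry T (k, r)) | r <- iota 0 (size (restr tau k))].

Definition labelled_parts (sigma : ptype) (f : {ffun 'I_(size sigma) -> ptype})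
    (k : nat) : seq (nat * nat) :=
  flatten [seq [seq ((block_of i).2 * p, nat_of_ord i)%N | p <- restr (f i) k]
          | i <- enum 'I_(size sigma)].

Lemma entryE (tau sigma : ptype) (T : filling tau sigma) x :
  constant_rows T -> entry T (cell_row x) = T x.
Proof.
move=> cT; rewrite /entry; case: pickP => [y /eqP /cT ->//|/(_ x)].
by rewrite eqxx.
Qed.

Lemma row_filledE (tau sigma : ptype) (T : filling tau sigma) i k r :
  constant_rows T -> (r < size (restr tau k))%N ->
  row_filled T i (k, r) = (entry T (k, r) == i :> nat).
Proof.
move=> cT /row_has_cell[x [xkr _]]; rewrite -xkr entryE//.
apply/forallP/idP => [/(_ x)|/eqP/val_inj Tx y]; first by rewrite eqxx.
by apply/implyP => /eqP/cT ->; rewrite Tx.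
Qed.

Lemma filled_lengthsE (tau sigma : ptype) (T : filling tau sigma) i k :
  constant_rows T -> filled_lengths T i k = with_label i (labelled_rows T k).
Proof.
move=> cT;
  rewrite /filled_lengths /with_label /labelled_rows filter_map -map_comp.
congr map; apply: eq_in_filter => r; rewrite mem_iota add0n => rk /=.
exact: row_filledE.
Qed.

Lemma size_labelled_rows (tau sigma : ptype) (T : filling tau sigma) k :
  size (labelled_rows T k) = size (restr tau k).
Proof. by rewrite size_map size_iota. Qed.

Lemma nth_labelled_rows (tau sigma : ptype) (T : filling tau sigma) k r :
  (r < size (restr tau k))%N ->
  nth (0, 0)%N (labelled_rows T k) r = (row_len tau (k, r), entry T (k, r)).
Proof. by move=> rk; rewrite (nth_map 0%N) ?size_iota// nth_iota. Qed.

Lemma labelled_rows1 (tau sigma : ptype) (T : filling tau sigma) k :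
  [seq x.1 | x <- labelled_rows T k] = restr tau k.
Proof. by rewrite -map_comp -[RHS](mkseq_nth 0%N). Qed.

Lemma labelled_rows_lt (tau sigma : ptype) (T : filling tau sigma) k :
  all (fun x => x.2 < size sigma)%N (labelled_rows T k).
Proof.
apply/allP => x /mapP[r]; rewrite mem_iota add0n => rk -> /=.
rewrite /entry; case: pickP => [y _ //|].
by have [y [yr _]] := row_has_cell rk; move=> /(_ y); rewrite yr eqxx.
Qed.

Lemma labelled_parts_lt (sigma : ptype)
    (f : {ffun 'I_(size sigma) -> ptype}) k :
  all (fun x => x.2 < size sigma)%N (labelled_parts f k).
Proof. by apply/allP => x /flatten_mapP[i _ /mapP[p _ ->]] /=. Qed.

Lemma with_label_flatten i (ss : seq (seq (nat * nat))) :
  with_label i (flatten ss) = flatten [seq with_label i s | s <- ss].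
Proof. by rewrite /with_label filter_flatten map_flatten -map_comp. Qed.

Lemma flatten_if1 (I : eqType) (T : Type) (i : I) (L : I -> seq T) (s : seq I) :
  uniq s -> flatten [seq if j == i then L j else [::] | j <- s]
            = if i \in s then L i else [::].
Proof.
elim: s => //= j s IHs /andP[js /IHs ->]; rewrite inE eq_sym.
by case: eqVneq => //= ij; rewrite ij (negbTE js) cats0.
Qed.

Lemma with_label_parts (sigma : ptype) (f : {ffun 'I_(size sigma) -> ptype})
    (i : 'I_(size sigma)) k :
  with_label i (labelled_parts f k)
  = [seq ((block_of i).2 * p)%N | p <- restr (f i) k].
Proof.
rewrite /labelled_parts with_label_flatten -map_comp.
transitivity (flatten [seq if j == i
    then [seq ((block_of j).2 * p)%N | p <- restr (f j) k] else [::]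
    | j <- enum 'I_(size sigma)]).
  congr flatten; apply: eq_map => j;
    rewrite /= /with_label filter_map -map_comp.
  case: eqVneq => [->|ji].
    by rewrite (eq_filter (a2 := predT)) ?filter_predT// => p /=; exact: eqxx.
  by rewrite (eq_filter (a2 := pred0)) ?filter_pred0// => p /=; exact/negbTE.
by rewrite flatten_if1 ?enum_uniq// mem_enum.
Qed.

Lemma by_degree_dilated (sigma : ptype)
    (f : {ffun 'I_(size sigma) -> ptype}) k :
  by_degree k (dilated f) = [seq x.1 | x <- labelled_parts f k].
Proof.
rewrite /by_degree /dilated /labelled_parts filter_flatten !map_flatten -!map_comp.
congr flatten; apply: eq_map => i /=.
by rewrite filter_map /restr -[LHS]map_comp -[RHS]map_comp -[RHS]map_comp.
Qed.

(** The lengths decrease because they are the parts of [tau|_k]; on rows of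
    equal length the labels increase by hypothesis. *)
Lemma labelled_rows_sorted (tau sigma : ptype) (T : filling tau sigma) k :
  constant_rows T -> increasing T -> sorted label_le (labelled_rows T k).
Proof.
move=> cT iT; apply/(sortedP (0, 0)%N) => r; rewrite size_labelled_rows => rk.
have rk' : (r < size (restr tau k))%N by exact: ltnW.
rewrite !nth_labelled_rows// /label_le /= orbC.
have /(sortedP 0%N)/(_ r rk) := restr_sorted tau k.
rewrite /= leq_eqVlt eq_sym => /orP[/eqP e|lt];
  last by rewrite [X in _ || X]lt orbT.
have [x [xr x0]] := row_has_cell rk'; have [y [yr y0]] := row_has_cell rk.
rewrite -xr -yr !entryE// /row_len {1 2}xr {1 2}yr /= e eqxx /=; apply/orP;
  left.
by apply: iT; rewrite ?x0 ?y0// xr yr.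
Qed.

Lemma subdiagram_inj (tau sigma : ptype) (T : filling tau sigma) i rho rho' :
  subdiagram T i rho -> subdiagram T i rho' -> rho = rho'.
Proof.
move=> [_ rT] [_ rT']; apply: ptype_perm; apply: perm_by_degree => k.
have /andP[_ m0] := block_of_gt0 i.
have mi : injective (fun p => (block_of i).2 * p)%N.
  by move=> p q /eqP; rewrite eqn_pmul2l// => /eqP.
apply: (perm_map_inj mi); rewrite -[by_degree k rho]/(restr rho k).
by apply: perm_trans (rT' k); rewrite perm_sym; exact: rT.
Qed.

Lemma ICRHT_subdiagram (tau sigma : ptype) (T : filling tau sigma) i :
  ICRHT tau sigma T -> subdiagram T i (rho_of T i).
Proof. by case=> _ /(_ i) [rho Tr] _; apply: (xgetPex ptype0); exists rho. Qed.

Lemma with_label_perm i (s t : seq (nat * nat)) :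
  perm_eq s t -> perm_eq (with_label i s) (with_label i t).
Proof. by move=> st; apply/perm_map/perm_filter. Qed.

(** Both lists are sorted for a total order, and for each label they have the
    same multiset of lengths.  Hence the types [rho_of T i] determine the
    list of rows of [T]. *)
Lemma ICRHT_labelled_rows (tau sigma : ptype) (T : filling tau sigma) k :
  ICRHT tau sigma T ->
  labelled_rows T k = sort label_le (labelled_parts [ffun i => rho_of T i] k).
Proof.
move=> iT; have [cT _ incT] := iT.
apply: (sorted_eq label_le_trans label_le_anti).
- exact: labelled_rows_sorted.
- by apply: sort_sorted; exact: label_le_total.
rewrite perm_sym perm_sort perm_sym.
apply: (perm_with_label (labelled_rows_lt T k) (labelled_parts_lt _ k)) => i.
rewrite -filled_lengthsE// with_label_parts ffunE.
by have [_ ->] := ICRHT_subdiagram i iT.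
Qed.

Lemma type_of_dilatedP (tau sigma : ptype)
    (f : {ffun 'I_(size sigma) -> ptype}) :
  type_of (dilated f) = tau <->
  forall k, perm_eq [seq x.1 | x <- labelled_parts f k] (restr tau k).
Proof.
split=> [<- k|ft].
  rewrite -by_degree_dilated perm_sym; apply/perm_map/perm_filter/perm_type_of.
  exact: dilated_positive.
apply: ptype_perm; rewrite (permPl (perm_type_of (dilated_positive f))).
by apply: perm_by_degree => k; rewrite by_degree_dilated.
Qed.

(** Row [r] of component [k] is filled with the label found at position [r]
    in the sorted list of the labelled parts of the family. *)
Lemma ICRHT_exists (tau sigma : ptype) (f : {ffun 'I_(size sigma) -> ptype}) :
  summand_types sigma f -> type_of (dilated f) = tau ->
  exists2 T : filling tau sigma,
    ICRHT tau sigma T & forall i, subdiagram T i (f i).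
Proof.
move=> fP /type_of_dilatedP ft.
pose L k := sort label_le (labelled_parts f k).
have Lperm k : perm_eq (L k) (labelled_parts f k) by rewrite perm_sort.
have Lsorted k : sorted label_le (L k).
  by apply: sort_sorted; exact: label_le_total.
have L1 k : [seq x.1 | x <- L k] = restr tau k.
  apply: (@sorted_eq _ geq).
  - by move=> a b c /= ba cb; exact: leq_trans cb ba.
  - by move=> a b; rewrite /= andbC => /anti_leq.
  - rewrite sorted_map; apply: sub_sorted (Lsorted k) => -[a b] [c d].
    by rewrite /label_le /=; lia.
  - exact: restr_sorted.
  - by apply: perm_trans (ft k); exact: perm_map.
have Lsize k : size (L k) = size (restr tau k) by rewrite -L1 size_map.
have [T TE] : exists T : filling tau sigma, forall x,
    T x = (nth (0, 0) (L (cell_row x).1) (cell_row x).2).2%N :> nat.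
  suff /fin_all_exists[g gE] : forall x : cell tau, exists i : 'I_(size sigma),
      i = (nth (0, 0) (L (cell_row x).1) (cell_row x).2).2%N :> nat.
    by exists [ffun x => g x] => x; rewrite ffunE.
  move=> x; have xL : nth (0, 0)%N (L (cell_row x).1) (cell_row x).2
      \in labelled_parts f (cell_row x).1.
    by rewrite -(perm_mem (Lperm _)) mem_nth// Lsize; exact: cell_row_mem.
  have lt := allP (labelled_parts_lt f (cell_row x).1) _ xL.
  by exists (Ordinal lt).
have cT : constant_rows T.
  by move=> x y xy; apply: val_inj; rewrite /= !TE xy.
have TL k : labelled_rows T k = L k.
  apply: (@eq_from_nth _ (0, 0)%N); rewrite size_labelled_rows ?Lsize// => r rk.
  rewrite nth_labelled_rows//; have [x [xkr _]] := row_has_cell rk.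
  rewrite -{2}xkr entryE// TE xkr /row_len /= -L1 (nth_map (0, 0)%N) ?Lsize//.
  by rewrite -surjective_pairing.
have subT i : subdiagram T i (f i).
  split; first exact: fP.
  move=> k; rewrite filled_lengthsE// TL -with_label_parts.
  exact: with_label_perm.
exists T => //; split=> //; first by move=> i; exists (f i).
move=> x y _ _ xyk xyl xyr.
have := cell_row_mem x; have := cell_row_mem y; rewrite -xyk => ylt xlt.
have := sorted_leq_nth label_le_trans label_le_refl (0, 0)%N (Lsorted (cell_row x).1).
move=> /(_ (cell_row x).2 (cell_row y).2);
  rewrite !inE !Lsize => /(_ xlt ylt xyr).
rewrite !TE -xyk -TL !nth_labelled_rows// /label_le /=.
by rewrite -surjective_pairing [in (_, _)]xyk -surjective_pairing xyl ltnn eqxx.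
Qed.

Lemma ICRHT_bij (tau sigma : ptype) :
  set_bij (ICRHT tau sigma)
    [set f | summand_types sigma f /\ type_of (dilated f) = tau]
    (fun T : filling tau sigma => [ffun i => rho_of T i]).
Proof.
split.
- move=> T iT; split=> [i|].
    by rewrite ffunE; have [] := ICRHT_subdiagram i iT.
  apply/type_of_dilatedP => k;
    rewrite -(labelled_rows1 T) ICRHT_labelled_rows//.
  by apply: perm_map; rewrite perm_sym perm_sort.
- move=> T U; rewrite !inE => iT iU TU; apply/ffunP => x; apply: val_inj => /=.
  have [cT _ _] := iT; have [cU _ _] := iU; rewrite -!entryE//.
  have xin := cell_row_mem x.
  have := ICRHT_labelled_rows (cell_row x).1 iT;
    rewrite TU -ICRHT_labelled_rows//.
  move=> /(congr1 (fun s => nth (0, 0)%N s (cell_row x).2)).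
  by rewrite !nth_labelled_rows// => -[]; rewrite -surjective_pairing.
- move=> f [fP ft]; have [T iT sT] := ICRHT_exists fP ft.
  exists T => //; apply/ffunP => i; rewrite ffunE.
  exact: subdiagram_inj (ICRHT_subdiagram i iT) (sT i).
Qed.

(** * The transition matrices *)

Lemma prod_opp (R : comNzRingType) (I : Type) (s : seq I) (F : I -> R) :
  \prod_(i <- s) - F i = (-1) ^+ size s * \prod_(i <- s) F i.
Proof.
elim: s => [|i s IHs]; first by rewrite !big_nil mulr1.
by rewrite !big_cons IHs exprS; ring.
Qed.

Lemma E_type_ICRHT eps n (sigma : ptype) : sigma ||- n ->
  E_type eps sigma = \sum_(tau \in [set tau : ptype | tau ||- n])
    (\sum_(T \in ICRHT tau sigma)
       \prod_(i < size sigma) exp_coef eps (rho_of T i)) *: ptensor tau.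
Proof.
move=> sn; rewrite (E_type_transition _ sn); apply: eq_fsbigr => tau _.
congr (_ *: _); rewrite (reindex_fsbig _ _ _ _ (ICRHT_bij tau sigma)).
by apply: eq_fsbigr => T _; apply: eq_bigr => i _; rewrite ffunE.
Qed.

Lemma transition_unique n F M N : is_transition n F M -> is_transition n F N ->
  forall sigma tau : ptype, sigma ||- n -> tau ||- n -> M tau sigma = N tau sigma.
Proof.
move=> FM FN sigma tau sn tn; apply/eqP; rewrite -subr_eq0; apply/eqP.
apply: (@ptensor_free n (fun t => M t sigma - N t sigma)) tn.
rewrite fsbig_finite; last exact: finite_types.
under eq_bigr do rewrite scalerBl.
rewrite sumrB -!fsbig_finite; try exact: finite_types.
by rewrite -FM// -FN// subrr.
Qed.

(** The common part of the two statements, for the weights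
    [exp_coef eps] of the sums [E_deg eps]. *)
Lemma transition_ICRHT n eps (F : ptype -> series)
    (w : forall tau sigma : ptype, filling tau sigma -> rat) :
  (forall sigma, F sigma = E_type eps sigma) ->
  (forall tau sigma (T : filling tau sigma),
     \prod_(i < size sigma) exp_coef eps (rho_of T i) = w tau sigma T) ->
  (exists M, is_transition n F M) /\
  (forall M, is_transition n F M ->
   forall sigma tau : ptype, sigma ||- n -> tau ||- n ->
     M tau sigma = \sum_(T \in ICRHT tau sigma) w tau sigma T).
Proof.
move=> FE wE.
have FN : is_transition n F
    (fun tau sigma => \sum_(T \in ICRHT tau sigma) w tau sigma T).
  move=> sigma sn; rewrite FE (E_type_ICRHT _ sn); apply: eq_fsbigr => tau _.
  by congr (_ *: _); apply: eq_fsbigr => T _; exact: wE.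
by split=> [|M FM]; [eexists; exact: FN|exact: transition_unique FM FN].
Qed.

Theorem corollary50 (n : nat) :
  ((exists M, is_transition n Eplus M) /\
   (forall M, is_transition n Eplus M ->
    forall sigma tau : ptype, sigma ||- n -> tau ||- n ->
      M tau sigma = \sum_(T \in ICRHT tau sigma) sgn_plus T * wt T)) /\
  ((exists M, is_transition n Eminus M) /\
   (forall M, is_transition n Eminus M ->
    forall sigma tau : ptype, sigma ||- n -> tau ||- n ->
      M tau sigma = \sum_(T \in ICRHT tau sigma) sgn_minus T * wt T)).
Proof.
split.
  apply: (@transition_ICRHT n 1) => [sigma|tau sigma T].
    by apply: eq_bigr => b _; rewrite Eplus_degE.
  rewrite /sgn_plus /wt -big_split; apply: eq_bigr => i _ /=.
  rewrite /exp_coef ztensorE; congr (_ / _).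
  exact: prod_opp.
apply: (@transition_ICRHT n (-1)) => [sigma|tau sigma T].
  by apply: eq_bigr => b _; rewrite Eminus_degE.
rewrite /sgn_minus /wt -big_split; apply: eq_bigr => i _ /=.
rewrite /exp_coef ztensorE; congr (_ / _).
rewrite /log_sign prod_opp big1 ?mulr1// => b _.
by rewrite opprK expr1n.
Qed.
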